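(* Let $f\in\mathcal{B}$, $f(z)=\sum_{n=0}^{\infty}a_nz^n$, let $p\in(0,2]$ and let $\{\varphi_n(r)\}_{n=0}^{\infty}\in\mathcal{F}$. Let $R\in(0,1)$ be the minimal positive root of the equation $p\varphi_0(x)=2\Phi_1(x)$, and suppose that $$p\,\varphi_0(r)>2\,\Phi_1(r)\quad\text{for all } r\in[0,R).$$ Then $$|a_0|^p\varphi_0(r)+\sum_{n=1}^{\infty}|a_n|\varphi_n(r)+\sum_{n=1}^{\infty}|a_n|^2\left(\frac{\varphi_{2n}(r)}{1+|a_0|}+\Phi_{2n+1}(r)\right)\le\varphi_0(r)\quad\text{for all } 0\le r\le R.$$ Moreover, the inequality is sharp in the following sense: if $p\varphi_0(x)<2\Phi_1(x)$ for all $x$ in some interval $(R,R+\epsilon)$ with $\epsilon>0$, then the number $R$ cannot be improved, i.e. for no $R'\in(R,1)$ does the displayed inequality hold for all $f\in\mathcal{B}$ and all $0\le r\le R'$.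
   Context: $\mathbb{D}=\{z\in\mathbb{C}:|z|<1\}$. $\mathcal{B}$ is the set of analytic functions $f$ on $\mathbb{D}$ with $\sup_{z\in\mathbb{D}}|f(z)|\le1$. $\mathcal{F}$ is the set of all sequences $\{\varphi_n(r)\}_{n=0}^{\infty}$ of nonnegative continuous functions on $[0,1)$ such that $\sum_{n=0}^{\infty}\varphi_n(r)$ converges locally uniformly with respect to $r\in[0,1)$. For $N\ge0$, $\Phi_N(r)=\sum_{n=N}^{\infty}\varphi_n(r)$. *)

(* Defs.v *)
From HB Require Import structures.
From mathcomp Require Import all_boot all_order all_algebra.
From mathcomp Require Import complex.
From mathcomp Require Import all_classical all_reals all_analysis.

Set Implicit Arguments.
Unset Strict Implicit.
Unset Printing Implicit Defensive.

Import Order.TTheory GRing.Theory Num.Theory.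
Import numFieldNormedType.Exports.
Import ComplexField.Normc.

Local Open Scope classical_set_scope.
Local Open Scope ring_scope.
Local Open Scope complex_scope.

Definition unit_disk (R : realType) : set R[i] := [set z | normc z < 1].

(* [R[i]^o] is [R[i]] seen as a normed space over itself, so that derivability
   in the direction [1] is complex differentiability. *)
Definition analytic_on_disk (R : realType) (f : R[i] -> R[i]) : Prop :=
  forall z, unit_disk z -> derivable (f : R[i]^o -> R[i]^o) z 1.

Definition classB (R : realType) (f : R[i] -> R[i]) : Prop :=
  analytic_on_disk f /\ forall z, unit_disk z -> normc (f z) <= 1.

Definition expansion_on_disk (R : realType) (f : R[i] -> R[i])
    (a : nat -> R[i]) : Prop :=
  forall z, unit_disk z ->
    series (fun n => a n * z ^+ n : R[i]^o) @ \oo --> (f z : R[i]^o).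

(* Functions on [0, 1) are total functions on [R] whose values outside [0, 1)
   are irrelevant. *)
Definition locally_uniformly_summable (R : realType) (phi : nat -> R -> R) :
    Prop :=
  exists S : R -> R, forall r : R, `[0, 1[%classic r ->
    exists2 U : set R, nbhs r U &
      {uniform U `&` `[0, 1[%classic,
        (fun n x => series (phi ^~ x) n) @ \oo --> S}.

Definition classF (R : realType) (phi : nat -> R -> R) : Prop :=
  [/\ forall n (r : R), `[0, 1[%classic r -> 0 <= phi n r,
      forall n, {within `[0, 1[%classic, continuous (phi n)} &
      locally_uniformly_summable phi].

(* Series of nonnegative terms are taken in the extended reals, where they
   always have a sum. *)
Definition Phi (R : realType) (phi : nat -> R -> R) (N : nat) (r : R) :
    \bar R :=
  (\sum_(N <= n <oo) (phi n r)%:E)%E.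

Definition bohr_inequality (R : realType) (phi : nat -> R -> R) (p : R)
    (a : nat -> R[i]) (r : R) : Prop :=
  ((normc (a 0%N) `^ p * phi 0%N r)%:E
   + \sum_(1 <= n <oo) (normc (a n) * phi n r)%:E
   + \sum_(1 <= n <oo) ((normc (a n) ^+ 2)%:E *
       ((phi (2 * n)%N r / (1 + normc (a 0%N)))%:E + Phi phi (2 * n + 1)%N r))
   <= (phi 0%N r)%:E)%E.

Definition minimal_positive_root (R : realType) (phi : nat -> R -> R)
    (p r0 : R) : Prop :=
  [/\ 0 < r0 < 1,
      (p * phi 0%N r0)%:E = (2%:E * Phi phi 1 r0)%E &
      forall x : R, 0 < x < r0 -> (p * phi 0%N x)%:E <> (2%:E * Phi phi 1 x)%E].

(* Main.v *)
Require Import Defs.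
From mathcomp Require Import all_boot all_order all_algebra.
From mathcomp Require Import cyclic separable cyclotomic complex.
From mathcomp Require Import ring lra zify.
From mathcomp Require Import all_classical all_reals all_analysis.

Set Implicit Arguments.
Unset Strict Implicit.
Unset Printing Implicit Defensive.

Import Order.TTheory GRing.Theory Num.Theory.
Import numFieldNormedType.Exports.
Import ComplexField.Normc.

Local Open Scope classical_set_scope.
Local Open Scope ring_scope.

(** The whole inequality comes down to sharp bounds on single Taylor
    coefficients.  Write b n for the modulus of a n.  For f bounded by 1 on the
    disk (Carlson's inequalities),
      b (2m+1) <= 1 - b 0 ^ 2 - ... - b m ^ 2,
      b (2m) <= 1 - b 0 ^ 2 - ... - b (m-1) ^ 2 - b m ^ 2 / (1 + b 0).
    Exchanging the two summations on the left of the Bohr inequality and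
    collecting the coefficient of phi k gives b k, plus b n ^ 2 for each n >= 1
    with 2n < k, plus b n ^ 2 / (1 + b 0) if k = 2n; by Carlson this is at most
    1 - b 0 ^ 2.  Hence the left-hand side is at most
      b 0 ^ p * phi 0 + (1 - b 0 ^ 2) * Phi_1,
    and 2 * Phi_1 <= p * phi 0 together with the tangent line inequality
    s ^ (p/2) <= 1 + (p/2) * (s - 1) at s = b 0 ^ 2 bounds it by phi 0.

    Carlson's inequalities express that multiplication by f is a contraction of
    the Hardy space H^2.  That fact is used in the form
      |[z^N] (f * g^2)| <= sum of the squared moduli of the coefficients of g
    for polynomials g (classB_coef_mul_sqr_le).  It holds because the
    coefficient is a mean of f * g^2 * z^(-N) over circles, and f is bounded
    by 1 there; for a polynomial in place of f, the mean over a circle is an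
    average over roots of unity, and partial sums of f reduce to that
    case.  The power of the bound lies in the choice of g.  Given g = q of
    degree < d, the improved test polynomial q + X^d * h, with N < 2d and h
    built from the conjugates of
    the low coefficients of f * q, gains exactly the sum of the squares of these
    coefficients (coef_mul_sqr_le_sub).  Taking q = 1 gives the odd case, and
    q = 1 + t * X^m with an optimal t the even one.

    For sharpness, the Bohr inequality at r is tested on the disk automorphisms
    (t - z) / (1 - t z), 0 < t < 1.  Both sides agree at t = 1; dividing by
    1 - t^2 and letting t tend to 1 leaves 2 * Phi_1 <= p * phi 0 at r
    (bohr_inequality_extremal), which is false just to the right of r0. *)

(** * Averages of polynomials over roots of unity *)

Section PolynomialsOnCircles.
Variable C : numClosedFieldType.

Lemma prim_root_exists (n : nat) :
  (0 < n)%N -> exists w : C, n.-primitive_root w.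
Proof.
pose p : {poly C} := 'X^n - 1; have [r Dp] := closed_field_poly_normal p.
move=> n_gt0; have mon_p : p \is monic by rewrite monicXnsubC.
rewrite (monicP mon_p) scale1r in Dp.
have rn1 : all n.-unity_root r by apply/allP => z; rewrite -root_prod_XsubC -Dp.
have sz_r : (n < (size r).+1)%N.
  by rewrite -(size_prod_XsubC r id) -Dp size_XnsubC.
have ur : uniq r.
  rewrite -separable_prod_XsubC -Dp.
  by apply: separable_Xn_sub_1; rewrite pnatr_eq0 -lt0n.
by have [|w _ ?] := hasP (has_prim_root n_gt0 rn1 ur _); last exists w.
Qed.

Lemma prim_root_norm n (w : C) : n.-primitive_root w -> `|w| = 1.
Proof.
move=> pw; apply/eqP; rewrite -(pexpr_eq1 (prim_order_gt0 pw))//.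
by rewrite -normrX (prim_expr_order pw) normr1.
Qed.

Lemma prim_root_sum n (w : C) (i j : 'I_n) : n.-primitive_root w ->
  \sum_(k < n) w ^+ (k * i) * (w ^+ (k * j))^* = (n * (i == j))%:R.
Proof.
move=> pw; have w1 := prim_root_norm pw.
have w0 : w != 0 by rewrite -normr_eq0 w1 oner_eq0.
pose v := w ^+ i * (w ^+ j)^*.
rewrite (eq_bigr (fun k : 'I_n => v ^+ k)) => [|k _]; last first.
  by rewrite /v exprMn -rmorphXn/= -!exprM ![(k * _)%N]mulnC.
have [e|neq] := eqVneq i j.
  have -> : v = 1 by rewrite /v e -normCK normrX w1 !expr1n.
  rewrite muln1 (eq_bigr (fun=> 1)) ?sumr_const ?card_ord// => k _.
  by rewrite expr1n.
have v1 : v != 1.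
  apply: contra neq => /eqP e; rewrite -val_eqE/=.
  have : w ^+ i = w ^+ j.
    rewrite -[RHS]mul1r -e /v -mulrA [(_)^* * _]mulrC -normCK normrX w1.
    by rewrite !expr1n mulr1.
  by move/eqP; rewrite (eq_prim_root_expr pw) !modn_small.
have vn : v ^+ n = 1.
  rewrite /v exprMn -rmorphXn/= -!exprM ![(_ * n)%N]mulnC !exprM.
  by rewrite (prim_expr_order pw) !expr1n rmorph1 mulr1.
rewrite muln0; apply: (mulfI (_ : v - 1 != 0)); first by rewrite subr_eq0.
by rewrite -subrX1 vn subrr mulr0.
Qed.

(** Cauchy's coefficient formula on the circle of radius rho: averaging over n
    equidistributed points is exact in degree below n. *)
Lemma coef_unity_roots n (w : C) (P : {poly C}) rho (i : 'I_n) :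
  n.-primitive_root w -> (size P <= n)%N ->
  \sum_(k < n) P.[rho * w ^+ k] * (w ^+ (k * i))^* = n%:R * (P`_i * rho ^+ i).
Proof.
move=> pw sP.
under eq_bigr => k _ do rewrite (horner_coef_wide _ sP) big_distrl/=.
rewrite exchange_big (bigD1 i)//= [X in _ + X]big1 ?addr0 => [|j ji].
  under eq_bigr => k _ do rewrite exprMn -exprM mulrA -mulrA.
  by rewrite -mulr_sumr prim_root_sum// eqxx muln1 mulrC.
under eq_bigr => k _ do rewrite exprMn -exprM mulrA -mulrA.
by rewrite -mulr_sumr prim_root_sum// (negPf ji) muln0 mulr0.
Qed.

Lemma parseval_unity_roots n (w : C) (P : {poly C}) rho :
  n.-primitive_root w -> (size P <= n)%N -> 0 <= rho ->
  \sum_(k < n) `|P.[rho * w ^+ k]| ^+ 2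
    = n%:R * \sum_(i < n) `|P`_i| ^+ 2 * rho ^+ (2 * i).
Proof.
move=> pw sP rho0.
under eq_bigr => k _ do
  rewrite normCK [X in _ * (X)^*](horner_coef_wide _ sP) rmorph_sum mulr_sumr/=.
rewrite exchange_big mulr_sumr; apply: eq_bigr => i _ /=.
under eq_bigr => k _ do rewrite rmorphM/= exprMn rmorphM/= -exprM mulrCA
 (mulrCA (P.[_])) mulrA.
rewrite -mulr_sumr coef_unity_roots// normCK rmorphXn/= (geC0_conj rho0).
by rewrite mulnC exprM expr2; ring.
Qed.

(** The coefficient is an average of P * g^2 times a function of modulus 1, and
    the average of the squared modulus of g is known by Parseval.  Squaring g,
    rather than taking a product g * h, spares the Cauchy-Schwarz inequality and
    loses nothing for Carlson's bounds, whose extremal test functions are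
    symmetric. *)
Lemma coef_mul_sqr_le (P g : {poly C}) rho K N : 0 <= rho ->
  (forall z, `|z| = rho -> `|P.[z]| <= K) ->
  `|(P * g ^+ 2)`_N| * rho ^+ N
     <= K * \sum_(i < size g) `|g`_i| ^+ 2 * rho ^+ (2 * i).
Proof.
move=> rho0 PK.
(* Enough points for both coef_unity_roots on P * g^2 and Parseval on g. *)
pose n := (maxn (size (P * g ^+ 2)%R) (maxn (size g) N.+1)).
have sPg : (size (P * g ^+ 2)%R <= n)%N by rewrite leq_maxl.
have sg : (size g <= n)%N by rewrite !leq_max leqnn orbT.
have Nn : (N < n)%N by rewrite !leq_max leqnn !orbT.
have n0 : (0 < n)%N by apply: leq_trans Nn.
have [w pw] := prim_root_exists n0.
have nR : 0 < n%:R :> C by rewrite ltr0n.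
have nw k : `|w ^+ k| = 1 by rewrite normrX (prim_root_norm pw) expr1n.
have -> : \sum_(i < size g) `|g`_i| ^+ 2 * rho ^+ (2 * i)
   = \sum_(i < n) `|g`_i| ^+ 2 * rho ^+ (2 * i).
  rewrite (big_ord_widen n (fun i => `|g`_i| ^+ 2 * rho ^+ (2 * i)))//.
  rewrite big_mkcond; apply: eq_bigr => i _; case: ltnP => // h.
  by rewrite nth_default// normr0 expr0n mul0r.
rewrite -(ler_pM2l nR) [leRHS]mulrCA -(parseval_unity_roots pw sg rho0).
have := coef_unity_roots rho (Ordinal Nn) pw sPg => /= e.
rewrite -[X in `|_| * X](ger0_norm (exprn_ge0 N rho0)) -normrM.
rewrite -[X in X * `|_|]normr_nat -normrM -e.
apply: le_trans (ler_norm_sum _ _ _) _; rewrite mulr_sumr.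
apply: ler_sum => k _; rewrite normrM norm_conjC nw mulr1 hornerM horner_exp.
rewrite normrM normrX ler_wpM2r ?exprn_ge0// PK//.
by rewrite normrM nw mulr1 ger0_norm.
Qed.

(** * Sharpened contraction bounds and Carlson's inequalities *)

(** The squared norm of g in the Hardy space H^2. *)
Definition coef_sqnorm (g : {poly C}) : C := \sum_(i < size g) `|g`_i| ^+ 2.

Lemma coef_sqnorm_wide n (g : {poly C}) : (size g <= n)%N ->
  coef_sqnorm g = \sum_(i < n) `|g`_i| ^+ 2.
Proof.
move=> sg; rewrite /coef_sqnorm (big_ord_widen n (fun i => `|g`_i| ^+ 2))//.
rewrite big_mkcond; apply: eq_bigr => i _; case: ltnP => // h.
by rewrite nth_default// normr0 expr0n.
Qed.

Lemma coef_sqnormD_shift d (q h : {poly C}) : (size q <= d)%N ->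
  coef_sqnorm (q + h * 'X^d) = coef_sqnorm q + coef_sqnorm h.
Proof.
move=> sq; rewrite (@coef_sqnorm_wide (d + size h)); last first.
  rewrite (leq_trans (size_polyD _ _))// geq_max (leq_trans sq) ?leq_addr//=.
  by rewrite (leq_trans (size_polyMleq _ _))// size_polyXn addnS/= addnC.
rewrite big_split_ord (coef_sqnorm_wide sq).
congr (_ + _); apply: eq_bigr => i _ /=.
  by rewrite coefD coefMXn ltn_ord addr0.
rewrite coefD coefMXn ltnNge leq_addr/= addKn nth_default ?add0r//.
by rewrite (leq_trans sq) ?leq_addr.
Qed.

Lemma polar_decomposition (z : C) : exists2 u : C, `|u| = 1 & z = `|z| * u.
Proof.
have [->|z0] := eqVneq z 0; first by exists 1; rewrite ?normr1 ?normr0 ?mul0r.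
exists (z / `|z|); last by rewrite mulrC divfK// normr_eq0.
by rewrite normrM normfV normr_id divff// normr_eq0.
Qed.

Section Contraction.
Variables (A : {poly C}) (N : nat).
Hypothesis HA : forall g : {poly C}, `|(A * g ^+ 2)`_N| <= coef_sqnorm g.

(** The bound HA, applied to q + X^d * h, improves itself: the cross term
    contributes 2 * s, where s is the subtracted sum, while the norm grows by s
    only, and the square of X^d * h does not reach degree N. *)
Lemma coef_mul_sqr_le_sub (d : nat) (q : {poly C}) : (size q <= d)%N ->
  (d <= N.+1)%N -> (N < 2 * d)%N ->
  `|(A * q ^+ 2)`_N| <= coef_sqnorm q - \sum_(i < N.+1 - d) `|(A * q)`_i| ^+ 2.
Proof.
move=> sq dN Nd; set e := (N.+1 - d)%N; set s := \sum_(i < e) _.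
have [u u1 Eu] := polar_decomposition (A * q ^+ 2)`_N.
have s0 : 0 <= s by apply: sumr_ge0 => i _; rewrite exprn_ge0.
(* The unit u aligns the cross term with the main coefficient, so that their
   moduli add up. *)
pose h := \poly_(j < e) (u * ((A * q)`_(e.-1 - j))^*).
have l2h : coef_sqnorm h = s.
  rewrite (coef_sqnorm_wide (size_poly _ _)) /s.
  rewrite [RHS](reindex_inj rev_ord_inj)/=.
  apply: eq_bigr => i _; rewrite coef_poly ltn_ord normrM u1 mul1r norm_conjC.
  by congr (`|(_)`_(_)| ^+ 2); rewrite -subn1 -subnDA add1n.
have lin : (A * q * h * 'X^d)`_N = u * s.
  rewrite coefMXn; case: ltnP => [lt|le].
    have e0 : e = 0%N by rewrite /e; apply/eqP; rewrite subn_eq0.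
    by rewrite /s e0 big_ord0 mulr0.
  have Ne : (N - d)%N = e.-1 by rewrite /e subSn.
  rewrite coefM Ne /s mulr_sumr; have e0 : (0 < e)%N by rewrite subn_gt0 ltnS.
  rewrite [RHS](_ : _ = \sum_(i < e.-1.+1) u * `|(A * q)`_i| ^+ 2); last first.
    by rewrite prednK.
  apply: eq_bigr => i _.
  have ie : (i <= e.-1)%N by rewrite -ltnS ltn_ord.
  rewrite coef_poly (leq_ltn_trans (leq_subr _ _)) ?prednK// subKn//.
  by rewrite mulrCA -normCK.
have quad : (A * h ^+ 2 * 'X^(2 * d))`_N = 0 by rewrite coefMXn Nd.
have := HA (q + h * 'X^d); rewrite coef_sqnormD_shift// l2h.
have -> : A * (q + h * 'X^d) ^+ 2
  = A * q ^+ 2 + (A * q * h * 'X^d) *+ 2 + A * h ^+ 2 * 'X^(2 * d).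
  by rewrite mulnC exprM; ring.
rewrite !coefD lin quad addr0 {1}Eu.
have -> : `|(A * q ^+ 2)`_N| * u + (u * s + u * s)
   = u * (`|(A * q ^+ 2)`_N| + s *+ 2) by ring.
rewrite normrM u1 mul1r ger0_norm ?addr_ge0 ?mulrn_wge0//.
by rewrite lerBrDr mulr2n addrA lerD2r.
Qed.

End Contraction.

Section Carlson.
Variables (a : nat -> C).
Hypothesis Ha : forall N (g : {poly C}),
  `|((\poly_(n < N.+1) a n) * g ^+ 2)`_N| <= coef_sqnorm g.

Lemma norm_coef_odd_le m : `|a (2 * m).+1| <= 1 - \sum_(i < m.+1) `|a i| ^+ 2.
Proof.
have := @coef_mul_sqr_le_sub _ _ (Ha (2 * m).+1) m.+1 1.
rewrite size_poly1 expr1n !mulr1 coef_poly ltnSn => /(_ isT).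
have dN : (m.+1 <= (2 * m).+2)%N by lia.
have Nd : ((2 * m).+1 < 2 * m.+1)%N by lia.
move=> /(_ dN Nd); rewrite /coef_sqnorm size_poly1 big_ord1 coef1 normr1 expr1n.
have -> : ((2 * m).+2 - m.+1)%N = m.+1 by lia.
move=> /le_trans; apply; rewrite lerD2l lerN2 le_eqVlt; apply/orP; left.
apply/eqP; apply: eq_bigr => i _; rewrite coef_poly.
by rewrite (leq_trans (ltn_ord i))//; lia.
Qed.

(** The test polynomial 1 + t * X^m yields, after aligning phases,
    |a_2m| + 2 rho |a_m| - rho^2 |a_0| <= 1 + rho^2 - (sum of squares)
    with rho the modulus of t; the value of rho below minimises the resulting
    bound (1 + |a_0|) * rho^2 - 2 rho |a_m|. *)
Lemma norm_coef_even_le m : (0 < m)%N ->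
  `|a (2 * m)%N| <= 1 - \sum_(i < m) `|a i| ^+ 2 - `|a m| ^+ 2 / (1 + `|a 0%N|).
Proof.
move=> m0.
have [u u1 Eu] := polar_decomposition (a (2 * m)%N).
have [v v1 Ev] := polar_decomposition (a m).
pose rho := `|a m| / (1 + `|a 0%N|).
have a01 : 0 < 1 + `|a 0%N| by rewrite ltr_pwDl.
have rho0 : 0 <= rho by rewrite divr_ge0// ltW.
(* With this phase, t * a m is a nonnegative multiple of u, the phase of
   a (2 * m). *)
pose t := rho * u * v^*.
have nt : `|t| = rho by rewrite /t 2!normrM norm_conjC u1 v1 !mulr1 ger0_norm.
pose q : {poly C} := 1 + t *: 'X^m.
have qE i : q`_i = (i == 0%N)%:R + t * (i == m)%:R.
  by rewrite coefD coef1 coefZ coefXn.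
have sq : (size q <= m.+1)%N.
  rewrite (leq_trans (size_polyD _ _))// geq_max size_poly1/=.
  by rewrite (leq_trans (size_scale_leq _ _)) ?size_polyXn.
have sum_eq0 k : (0 < k)%N -> \sum_(i < k) (i == 0%N :> nat)%:R = 1 :> C.
  by case: k => // k _; rewrite big_ord_recl big1 ?addr0.
have l2q : coef_sqnorm q = 1 + rho ^+ 2.
  rewrite (coef_sqnorm_wide sq) big_ord_recr/=.
  rewrite (eq_bigr (fun i : 'I_m => (i == 0%N :> nat)%:R)).
    rewrite sum_eq0//.
    by rewrite qE eqxx gtn_eqF// add0r mulr1 nt.
  move=> i _; rewrite qE (ltn_eqF (ltn_ord i)) mulr0 addr0.
  by case: eqP => _; rewrite ?normr1 ?normr0 ?expr1n ?expr0n.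
pose A : {poly C} := \poly_(n < (2 * m).+1) a n.
have Aq i : (i < m)%N -> (A * q)`_i = a i.
  move=> im; rewrite mulrDr mulr1 -scalerAr coefD coefZ coefMXn im mulr0 addr0.
  by rewrite coef_poly ltnS (leq_trans (ltnW im))// leq_pmull.
have Aq2 : (A * q ^+ 2)`_(2 * m) = a (2 * m)%N + t * a m *+ 2 + t ^+ 2 * a 0%N.
  have -> : A * q ^+ 2 =
      A + (t *: (A * 'X^m)) *+ 2 + t ^+ 2 *: (A * 'X^(2 * m)).
    by rewrite /q -!mul_polyC mulnC exprM rmorphXn/=; ring.
  rewrite !coefD !coefZ !coefMXn ltnn subnn ltnNge leq_pmull//=.
  have -> : (2 * m - m)%N = m by lia.
  rewrite !coef_poly ltnSn ltnS leq_pmull//=.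
have := coef_mul_sqr_le_sub (Ha (2 * m)) sq.
rewrite -/A Aq2 l2q.
have dN : (m.+1 <= (2 * m).+1)%N by lia.
have Nd : (2 * m < 2 * m.+1)%N by lia.
move=> /(_ dN Nd); have -> : ((2 * m).+1 - m.+1)%N = m by lia.
rewrite (eq_bigr (fun i : 'I_m => `|a i| ^+ 2)) => [h|i _]; last by rewrite Aq.
have tam : t * a m = rho * `|a m| * u.
  rewrite Ev normrM normr_id v1 mulr1 /t.
  have -> : rho * u * v^* * (`|a m| * v) = rho * `|a m| * u * (v * v^*) by ring.
  by rewrite -normCK v1 expr1n mulr1.
have := le_trans (lerB_normD _ _) h.
rewrite normrM normrX nt tam {1}Eu.
have -> : `|a (2 * m)%N| * u + (rho * `|a m| * u) *+ 2
  = (`|a (2 * m)%N| + (rho * `|a m|) *+ 2) * u by ring.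
have ram0 : 0 <= rho * `|a m| by apply: mulr_ge0.
rewrite normrM u1 mulr1 ger0_norm; last by rewrite addr_ge0// mulrn_wge0.
set S := \sum_(_ < _) _; set y := `|a (2 * m)%N|.
have ra : rho * (1 + `|a 0%N|) = `|a m| by rewrite divfK// gt_eqF.
have -> : `|a m| ^+ 2 / (1 + `|a 0%N|) = rho * `|a m|.
  by rewrite /rho expr2 mulrAC.
rewrite -subr_ge0 => h1; rewrite -subr_ge0.
suff -> : 1 - S - rho * `|a m| - y
  = 1 + rho ^+ 2 - S - (y + (rho * `|a m|) *+ 2 - rho ^+ 2 * `|a 0%N|) by [].
by rewrite -ra; ring.
Qed.

End Carlson.
End PolynomialsOnCircles.

Local Open Scope complex_scope.

(** * From polynomials to bounded analytic functions *)

Section BoundedAnalytic.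
Variable R : realType.
Local Notation C := (R[i]).

(** Both limits of the proof, radius to 1 and Moebius parameter to 1, are taken
    with this lemma. *)
Lemma poly_ge0_at1 (q : {poly R}) :
  (forall x, 0 < x < 1 -> 0 <= q.[x]) -> 0 <= q.[1].
Proof.
move=> q0.
have h : horner q x @[x --> 1^'-] --> q.[1].
  by apply: cvg_at_left_filter; exact: continuous_horner.
apply: cvgr_to_ge h _; near=> x; apply: q0; apply/andP; split; near: x.
  exact: nbhs_left_gt.
exact: nbhs_left_lt.
Unshelve. all: by end_near. Qed.

Lemma complex_normE (z : C) : `|z| = (normc z)%:C. Proof. by []. Qed.

Lemma normc_real (x : R) : normc x%:C = `|x|.
Proof. by rewrite /= expr0n/= addr0 sqrtr_sqr. Qed.

Lemma normc_ge0 (z : C) : 0 <= normc z.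
Proof. by case: z => x y /=; exact: sqrtr_ge0. Qed.

Lemma coef_sqnorm_real (g : {poly C}) :
  coef_sqnorm g = (\sum_(i < size g) normc g`_i ^+ 2)%:C.
Proof. by rewrite rmorph_sum; apply: eq_bigr => i _; rewrite rmorphXn. Qed.

Lemma geom_tail_le (F : numFieldType) (q : F) (m n : nat) : 0 <= q < 1 ->
  (m <= n)%N -> \sum_(m <= k < n) q ^+ k <= q ^+ m / (1 - q).
Proof.
move=> /andP[q0 q1] mn; rewrite ler_pdivlMr ?subr_gt0//.
have -> : (\sum_(m <= k < n) q ^+ k) * (1 - q) = q ^+ m - q ^+ n.
  rewrite big_distrl/= (@telescope_sumr_eq _ m n (fun k => - q ^+ k))//.
    by rewrite opprK addrC.
  by move=> k _; rewrite exprSr; ring.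
by rewrite lerBlDr lerDl exprn_ge0.
Qed.

Variables (f : C -> C) (a : nat -> C).
Hypotheses (fB : classB f) (fa : expansion_on_disk f a).

(** On a circle of radius rho < 1 the Taylor series converges uniformly, being
    dominated by a geometric series: convergence at a point of modulus s > rho
    makes the terms at s eventually at most 1. *)
Lemma partial_sum_circle_le (rho eps : R) N : 0 < rho < 1 -> 0 < eps ->
  exists2 L, (N < L)%N & forall z : C, `|z| = rho%:C ->
    `|(\poly_(n < L) a n).[z]| <= (1 + eps)%:C.
Proof.
move=> /andP[rho0 rho1] eps0.
pose s := (1 + rho) / 2.
have [rs s1] : rho < s /\ s < 1 by rewrite /s; split; lra.
have s0 : 0 < s by lra.
have ns : `|s%:C : C| = s%:C by rewrite complex_normE normc_real gtr0_norm.
have sdisk : unit_disk s%:C by rewrite /unit_disk /mkset normc_real gtr0_norm.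
have := fa sdisk => /cvgP/cvg_series_cvg_0/cvgr0_norm_le/(_ 1 ltr01).
move=> [M _ HM].
have [q [qs q0 q1]] : exists q, [/\ q * s = rho, 0 <= q & q < 1].
  exists (rho / s); rewrite divfK ?gt_eqF//; split=> //.
    by rewrite divr_ge0// ltW.
  by rewrite ltr_pdivrMr ?mul1r.
have qC : 0 <= q%:C < 1 by rewrite ler0c q0 ltcR.
have term z k : `|z| = rho%:C -> (M <= k)%N -> `|a k * z ^+ k| <= q%:C ^+ k.
  move=> zr /HM/=; rewrite !normrM !normrX zr ns.
  have -> : rho%:C = q%:C * s%:C.
    by rewrite -rmorphM/= qs.
  move=> h; rewrite exprMn mulrCA -[leRHS]mulr1.
  by rewrite ler_wpM2l// exprn_ge0// ler0c.
have e2 : 0 < eps / 2 by rewrite divr_gt0.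
have [L [ML NL qL]] : exists L, [/\ (M <= L)%N, (N < L)%N &
    q ^+ L / (1 - q) <= eps / 2].
  have q1' : `|q| < 1 by rewrite ger0_norm.
  have e3 : 0 < eps / 2 * (1 - q) by rewrite mulr_gt0// subr_gt0.
  have [K _ HK] := (cvgr0_norm_le _ (cvg_expr q1')) _ e3.
  exists (maxn (maxn M N.+1) K); split; rewrite ?leq_max ?leqnn ?orbT//.
  rewrite ler_pdivrMr ?subr_gt0//.
  have /HK/= : (K <= maxn (maxn M N.+1) K)%N by rewrite leq_max leqnn orbT.
  by rewrite ger0_norm// exprn_ge0.
exists L => // z zr; rewrite horner_poly.
have zdisk : unit_disk z.
  by rewrite /unit_disk /mkset -ltcR -complex_normE zr ltcR.
have e2C : (0 : C) < (eps / 2)%:C by rewrite ltcR.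
have [K _ HK] := (cvgrPdist_le _ _).1 (fa zdisk) _ e2C.
have := HK (maxn K L) (leq_maxl _ _); rewrite /series/=.
rewrite (@big_cat_nat _ _ _ L) ?leq_maxr//= big_mkord.
set S := \sum_(_ < _) _; set T := \sum_(_ <= _ < _) _ => ST.
have TL : `|T| <= (eps / 2)%:C.
  apply: le_trans (ler_norm_sum _ _ _) _.
  apply: (@le_trans _ _ (\sum_(L <= k < maxn K L) q%:C ^+ k)).
    apply: ler_sum_nat => k /andP[Lk _]; apply: term => //.
    exact: leq_trans Lk.
  apply: le_trans (geom_tail_le qC (leq_maxr _ _)) _.
  have -> : q%:C ^+ L / (1 - q%:C) = (q ^+ L / (1 - q))%:C.
    by rewrite fmorph_div rmorphXn rmorphB.
  by rewrite lecR.
have fz : `|f z| <= 1 by rewrite complex_normE lecR; apply: fB.2.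
have -> : S = f z - (f z - (S + T)) - T by ring.
apply: le_trans (ler_normB _ _) _; apply: le_trans (lerD (ler_normB _ _) TL) _.
have -> : (1 + eps)%:C = 1 + (eps / 2)%:C + (eps / 2)%:C.
  by rewrite -!rmorphD/=; congr (_ %:C); field.
by rewrite lerD2r lerD.
Qed.

(** Only the coefficients up to N of the first factor matter, so that f may be
    replaced by a longer partial sum, which is bounded by 1 + eps on the circle
    of radius x; the choice eps = 1 - x leaves a single limit x -> 1. *)
Lemma classB_coef_mul_sqr_le N (g : {poly C}) :
  `|((\poly_(n < N.+1) a n) * g ^+ 2)`_N| <= coef_sqnorm g.
Proof.
set c := (_)`_N; rewrite coef_sqnorm_real complex_normE lecR.
set G := \sum_(_ < _) _.
have G0 : 0 <= G by apply: sumr_ge0 => i _; exact: sqr_ge0.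
have := @poly_ge0_at1 ((2%:P - 'X) * G%:P - (normc c)%:P * 'X^N).
rewrite !hornerE expr1n mulr1 subr_ge0.
have -> : (2 - 1) * G = G by ring.
apply => x /andP[x0 x1]; rewrite !hornerE subr_ge0.
have [||L NL HL] := @partial_sum_circle_le x (1 - x) N;
  rewrite ?x0 ?x1 ?subr_gt0//.
have xC : (0 : C) <= x%:C by rewrite ler0c ltW.
have := coef_mul_sqr_le g N xC HL.
have -> : ((\poly_(n < L) a n) * g ^+ 2)`_N = c.
  rewrite /c !coefM; apply: eq_bigr => i _; rewrite !coef_poly ltn_ord.
  by rewrite (leq_trans (ltn_ord i)).
rewrite complex_normE -rmorphXn/= -rmorphM/= => h; rewrite -lecR (le_trans h)//.
have -> : 1 + (1 - x) = 2 - x by ring.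
rewrite rmorphM/= ler_wpM2l ?lecR//; first by lra.
rewrite -coef_sqnorm_real; apply: ler_sum => i _.
by rewrite ler_piMr ?exprn_ge0// exprn_ile1// lecR ltW.
Qed.

Lemma normc_coef_odd_le m :
  normc (a (2 * m).+1) <= 1 - \sum_(i < m.+1) normc (a i) ^+ 2.
Proof.
have := norm_coef_odd_le classB_coef_mul_sqr_le m.
rewrite -lecR rmorphB rmorph_sum/=.
by under [in X in _ -> X]eq_bigr => i _ do rewrite rmorphXn.
Qed.

Lemma normc_coef_even_le m : (0 < m)%N -> normc (a (2 * m)%N) <=
  1 - \sum_(i < m) normc (a i) ^+ 2 - normc (a m) ^+ 2 / (1 + normc (a 0%N)).
Proof.
move=> m0; have := norm_coef_even_le classB_coef_mul_sqr_le m0.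
rewrite -lecR !rmorphB rmorph_sum/= fmorph_div rmorphXn rmorphD/=.
by under [in X in _ -> X]eq_bigr => i _ do rewrite rmorphXn.
Qed.

End BoundedAnalytic.

(** * The tangent line inequality for powers *)

Section TangentLine.
Variable R : realType.

(** Young's inequality for the product of s ^ q and 1, with conjugate exponents
    1 / q and 1 / (1 - q). *)
Lemma powR_le_tangent (s q : R) :
  0 <= s -> 0 < q <= 1 -> s `^ q <= 1 + q * (s - 1).
Proof.
move=> s0 /andP[q0]; rewrite le_eqVlt => /orP[/eqP ->|q1].
  by rewrite powRr1//; lra.
have q1' : 0 < 1 - q by rewrite subr_gt0.
have := @conjugate_powR R (s `^ q) 1 q^-1 (1 - q)^-1 (powR_ge0 _ _) ler01.
rewrite !invr_gt0 !invrK => /(_ q0 q1'); rewrite mulr1 -powRrM divff ?gt_eqF//.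
rewrite powRr1// powR1 mul1r => h; have e : q + (1 - q) = 1 by ring.
by have := h e; lra.
Qed.

Lemma powR_half (t p : R) : 0 <= t -> (t ^+ 2) `^ (p / 2) = t `^ p.
Proof.
by move=> t0; rewrite -powR_mulrn// -powRrM mulrC divfK.
Qed.

Lemma powR_add_le (t p : R) : 0 <= t -> 0 < p <= 2 ->
  t `^ p + p / 2 * (1 - t ^+ 2) <= 1.
Proof.
move=> t0 p2; rewrite -powR_half//.
have := @powR_le_tangent (t ^+ 2) (p / 2) (sqr_ge0 _).
by have -> : 0 < p / 2 <= 1 by [lra]; move=> /(_ isT); lra.
Qed.

(** The reverse estimate near t = 1, needed for sharpness: it is powR_add_le at
    1 / t combined with 1 - y <= 1 / y - 1 for y = t ^ p. *)
Lemma powR_sub_le (t p : R) : 0 < t -> 0 < p <= 2 ->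
  (1 - t `^ p) * t ^+ 2 <= p / 2 * (1 - t ^+ 2).
Proof.
move=> t0 p2.
have tv0 : 0 <= t^-1 by rewrite invr_ge0 ltW.
have := powR_add_le tv0 p2.
have -> : t^-1 `^ p = (t `^ p)^-1.
  by rewrite -powR_inv1 ?ltW// -powRrM mulN1r powRN.
set y := t `^ p; have y0 : 0 < y by exact: powR_gt0.
have yy : 1 - y <= y^-1 - 1.
  rewrite -subr_ge0; have -> : y^-1 - 1 - (1 - y) = (1 - y) ^+ 2 / y.
    by field; rewrite gt_eqF.
  by rewrite divr_ge0 ?sqr_ge0// ltW.
move=> h; have {}h : 1 - y <= p / 2 * (t^-1 ^+ 2 - 1) by lra.
have -> : p / 2 * (1 - t ^+ 2) = p / 2 * (t^-1 ^+ 2 - 1) * t ^+ 2.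
  by field; rewrite gt_eqF.
by rewrite ler_wpM2r// sqr_ge0.
Qed.

End TangentLine.

(** * Exchanging the summations in the Bohr sum *)

Section BohrSeries.
Variable R : realType.
Variables (b phi : nat -> R).
Hypotheses (b0 : forall n, 0 <= b n) (phi0 : forall n, 0 <= phi n).
Hypothesis bodd : forall m, b (2 * m).+1 <= 1 - \sum_(i < m.+1) b i ^+ 2.
Hypothesis beven : forall m, (0 < m)%N ->
  b (2 * m)%N <= 1 - \sum_(i < m) b i ^+ 2 - b m ^+ 2 / (1 + b 0%N).

(** The factor with which b n ^ 2 * phi k occurs in the Bohr sum. *)
Definition carlson_weight n k : R :=
  if k == (2 * n)%N then (1 + b 0%N)^-1 else ((2 * n < k)%N)%:R.

Lemma carlson_weight_ge0 n k : 0 <= carlson_weight n k.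
Proof.
by rewrite /carlson_weight; case: ifP => // _; rewrite invr_ge0 addr_ge0.
Qed.

Lemma carlson_weight_sum_le k : (0 < k)%N ->
  b k + \sum_(1 <= n < k) b n ^+ 2 * carlson_weight n k <= 1 - b 0%N ^+ 2.
Proof.
move=> k0; pose m := k./2.
(* The weights vanish beyond the half of k. *)
have tail : \sum_(m.+1 <= n < k) b n ^+ 2 * carlson_weight n k = 0.
  rewrite big_nat_cond big1// => n; rewrite andbT => /andP[mn nk].
  rewrite /carlson_weight ifF ?ltnNge; last by apply/eqP; rewrite /m in mn; lia.
  by rewrite (_ : (k <= 2 * n)%N) ?mulr0//; rewrite /m in mn; lia.
have [ko|ke] := boolP (odd k).
  have Ek : k = (2 * m).+1 by rewrite /m; lia.
  rewrite (@big_cat_nat _ _ _ m.+1)//; last by lia.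
  rewrite tail /= addr0 (eq_big_nat _ _ (F2 := fun n => b n ^+ 2)); last first.
    move=> n nm; rewrite /carlson_weight ifF; last by apply/eqP; lia.
    by rewrite (_ : (2 * n < k)%N) ?mulr1//; lia.
  have := bodd m; rewrite -Ek -(big_mkord xpredT (fun i => b i ^+ 2)).
  by rewrite big_ltn//; lra.
have Ek : k = (2 * m)%N by rewrite /m; lia.
have m0 : (0 < m)%N by lia.
rewrite (@big_cat_nat _ _ _ m.+1)//; last by lia.
rewrite tail /= addr0 big_nat_recr//= {2}/carlson_weight -Ek eqxx.
rewrite (eq_big_nat _ _ (F2 := fun n => b n ^+ 2)); last first.
  move=> n nm; rewrite /carlson_weight ifF; last by apply/eqP; lia.
  by rewrite (_ : (2 * n < k)%N) ?mulr1//; lia.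
have := beven m0; rewrite -Ek -(big_mkord xpredT (fun i => b i ^+ 2)).
by rewrite big_ltn//; lra.
Qed.

Local Open Scope ereal_scope.

Lemma eq_eseries_nat N (u v : nat -> \bar R) :
  (forall n, (N <= n)%N -> u n = v n) ->
  \sum_(N <= n <oo) u n = \sum_(N <= n <oo) v n.
Proof.
move=> uv; apply/congr_lim/funext => n; apply: eq_big_nat => k /andP[Nk _].
exact: uv.
Qed.

Lemma carlson_weight_series n : (0 < n)%N ->
  (phi (2 * n)%N / (1 + b 0%N))%:E + \sum_(2 * n + 1 <= k <oo) (phi k)%:E
  = \sum_(1 <= k <oo) (carlson_weight n k * phi k)%:E.
Proof.
move=> n0; rewrite [RHS](nneseries_split _ (2 * n)); last first.
  by move=> k _; rewrite lee_fin mulr_ge0// carlson_weight_ge0.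
rewrite add1n addn1 big_nat_recr ?muln_gt0//= big_nat_cond big1 ?add0e.
  rewrite {1}/carlson_weight eqxx mulrC; congr (_ + _).
  apply: eq_eseries_nat => k kn.
  by rewrite /carlson_weight ifF ?kn ?mul1r//; apply/eqP; lia.
move=> k; rewrite andbT => /andP[_ kn].
rewrite /carlson_weight ifF; last by apply/eqP; lia.
by rewrite ltnNge ltnW// mul0r.
Qed.

Lemma bohr_series_le :
  \sum_(1 <= n <oo) (b n * phi n)%:E
   + \sum_(1 <= n <oo) ((b n ^+ 2)%:E *
       ((phi (2 * n)%N / (1 + b 0%N))%:E
        + \sum_(2 * n + 1 <= k <oo) (phi k)%:E))
  <= (1 - b 0%N ^+ 2)%:E * \sum_(1 <= n <oo) (phi n)%:E.
Proof.
have pos n k : 0 <= (b n ^+ 2 * (carlson_weight n k * phi k))%:E.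
  by rewrite lee_fin mulr_ge0 ?sqr_ge0// mulr_ge0// carlson_weight_ge0.
have -> : \sum_(1 <= n <oo) ((b n ^+ 2)%:E *
       ((phi (2 * n)%N / (1 + b 0%N))%:E
        + \sum_(2 * n + 1 <= k <oo) (phi k)%:E))
  = \sum_(1 <= n <oo) \sum_(1 <= k <oo)
      (b n ^+ 2 * (carlson_weight n k * phi k))%:E.
  apply: eq_eseries_nat => n n0.
  rewrite carlson_weight_series// -nneseriesZl// => k _.
  by rewrite lee_fin mulr_ge0// carlson_weight_ge0.
have -> : \sum_(1 <= n <oo) \sum_(1 <= k <oo)
      (b n ^+ 2 * (carlson_weight n k * phi k))%:E
  = \sum_(1 <= k <oo) \sum_(1 <= n <oo)
      (b n ^+ 2 * (carlson_weight n k * phi k))%:E.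
  rewrite [LHS]eseries_cond [RHS]eseries_cond.
  under eq_eseriesr do rewrite eseries_cond.
  under [RHS]eq_eseriesr do rewrite eseries_cond.
  exact: nneseries_interchange.
rewrite -nneseriesD; first last.
- by move=> k _ _; exact: nneseries_ge0.
- by move=> k _ _; rewrite lee_fin mulr_ge0.
rewrite -nneseriesZl; last by move=> k _; rewrite lee_fin.
rewrite (@eq_eseries_nat _ _ (fun k =>
    ((b k + \sum_(1 <= n < k) b n ^+ 2 * carlson_weight n k)
      * phi k)%:E)) => [|k k0].
  rewrite eseries_cond [leRHS]eseries_cond; apply: lee_nneseries => k /=.
    move=> _ _; rewrite lee_fin mulr_ge0// addr_ge0//.
    by apply: sumr_ge0 => n _; rewrite mulr_ge0 ?sqr_ge0 ?carlson_weight_ge0.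
  by move=> k0; rewrite -EFinM lee_fin ler_wpM2r// carlson_weight_sum_le.
rewrite (nneseries_split _ k.-1); last by move=> n _.
rewrite add1n prednK// eseries0 ?adde0 => [|n kn _]; last first.
  rewrite /carlson_weight ifF; last by apply/eqP; lia.
  by rewrite (_ : (2 * n < k)%N = false) ?mul0r ?mulr0//; lia.
rewrite sumEFin -EFinD mulrDl mulr_suml; congr (_ + _)%:E.
by apply: eq_bigr => n _; rewrite mulrA.
Qed.

End BohrSeries.

(** * The extremal disk automorphisms *)

Section Moebius.
Variables (R : realType) (t : R).
Hypothesis t01 : 0 < t < 1.
Local Notation C := (R[i]).

Definition moebius (z : C) : C := (t%:C - z) / (1 - t%:C * z).
Definition moebius_coef (n : nat) : C :=
  if n is m.+1 then - ((1 - t ^+ 2) * t ^+ m)%:C else t%:C.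

Lemma moebius_den_neq0 z : unit_disk z -> 1 - t%:C * z != 0.
Proof.
have /andP[t0 t1] := t01; rewrite /unit_disk /mkset => z1.
rewrite subr_eq0; apply/eqP => /(congr1 (@normc R)).
rewrite normc1 normcM normc_real gtr0_norm// => e.
have := normc_ge0 z; nra.
Qed.

Lemma moebius_classB : classB moebius.
Proof.
have /andP[t0 t1] := t01.
split=> z zD; have den := moebius_den_neq0 zD.
  have dn : derivable ((fun w => t%:C - w) : C^o -> C^o) z 1.
    by apply: derivableB; [exact: derivable_cst|exact: derivable_id].
  have dd : derivable ((fun w => 1 - t%:C * w) : C^o -> C^o) z 1.
    apply: derivableB; first exact: derivable_cst.
    by apply: derivableM; [exact: derivable_cst|exact: derivable_id].
  have di : derivable ((fun w => (1 - t%:C * w)^-1) : C^o -> C^o) z 1.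
    exact: (@derivableV _ _ ((fun w => 1 - t%:C * w) : C^o -> C^o)).
  exact: (derivableM dn di).
rewrite /moebius normcM normcV ler_pdivrMr ?mul1r; last first.
  rewrite lt_neqAle normc_ge0 andbT eq_sym; apply: contra den => /eqP h.
  by apply/eqP/eq0_normc.
move: zD {den}; rewrite /unit_disk /mkset; case: z => x y /=.
rewrite -{1}sqrtr1 ltr_sqrt// => h; rewrite ler_wsqrtr//.
have h2 : 0 <= (1 - t ^+ 2) * (1 - (x ^+ 2 + y ^+ 2)).
  by rewrite mulr_ge0//; nra.
nra.
Qed.

Lemma moebius_expansion : expansion_on_disk moebius moebius_coef.
Proof.
have /andP[t0 t1] := t01.
move=> z zD; have den := moebius_den_neq0 zD.
pose q := t * normc z.
have q0 : 0 <= q by rewrite mulr_ge0 ?normc_ge0// ltW.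
have q1 : `|q| < 1.
  by rewrite ger0_norm//; move: zD; rewrite /unit_disk /mkset /q => h; nra.
pose K := normc ((1 - t ^+ 2)%:C * z / (1 - t%:C * z)).
have K0 : 0 <= K by exact: normc_ge0.
have S n : moebius z - series (fun n => moebius_coef n * z ^+ n) n.+1
   = - ((1 - t ^+ 2)%:C * z / (1 - t%:C * z) * (t%:C * z) ^+ n).
  (* The remainder after n + 1 terms is geometric. *)
  rewrite /moebius /series/= big_nat_recl// expr0 mulr1.
  elim: n => [|n IH].
    rewrite big_geq// rmorphB/= rmorphXn/=; field; exact: den.
  rewrite big_nat_recr//= [X in _ - X]addrA opprD addrA IH.
  rewrite rmorphM/= rmorphXn/= [_ ^+ n.+1 in RHS]exprSr exprMn (exprSr z).
  by field; exact: den.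
apply/cvgrPdist_le => e; rewrite ltcE /= => /andP[/eqP ei er].
have ee : e = (complex.Re e)%:C by move: ei; case: (e) => u v /= ->.
have e' : 0 < complex.Re e / (K + 1) by rewrite divr_gt0// ltr_pwDr.
have [M _ HM] := (cvgr0_norm_le _ (cvg_expr q1)) _ e'.
exists M.+1 => // -[|n] //= Mn.
rewrite S normrN ee complex_normE lecR normcM -/K.
have := HM n Mn; rewrite /= ger0_norm ?exprn_ge0//.
rewrite ler_pdivlMr ?ltr_pwDr// => h.
have -> : normc ((t%:C * z) ^+ n) = q ^+ n.
  elim: {Mn h} n => [|n IH]; first by rewrite !expr0 normc1.
  by rewrite !exprS normcM IH normcM normc_real gtr0_norm.
rewrite mulrC; apply: le_trans h; rewrite ler_wpM2l ?exprn_ge0//.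
by rewrite lerDl.
Qed.

End Moebius.

(** * The Bohr inequality and its sharpness *)

Lemma bohr_inequality_holds (R : realType) (p r : R) (phi : nat -> R -> R)
    (f : R[i] -> R[i]) (a : nat -> R[i]) :
  0 < p <= 2 -> (forall n, 0 <= phi n r) ->
  (2%:E * Phi phi 1 r <= (p * phi 0%N r)%:E)%E ->
  classB f -> expansion_on_disk f a -> bohr_inequality phi p a r.
Proof.
move=> hp phi0 hle fB fa.
pose b n := normc (a n).
have b0 n : 0 <= b n by exact: normc_ge0.
have bodd m : b (2 * m).+1 <= 1 - \sum_(i < m.+1) b i ^+ 2.
  exact: normc_coef_odd_le fB fa m.
have beven m : (0 < m)%N -> b (2 * m)%N <=
    1 - \sum_(i < m) b i ^+ 2 - b m ^+ 2 / (1 + b 0%N).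
  exact: normc_coef_even_le fB fa m.
have b01 : 0 <= 1 - b 0%N ^+ 2.
  by have := bodd 0%N; rewrite big_ord1; exact: le_trans.
have := bohr_series_le b0 phi0 bodd beven.
rewrite /bohr_inequality -addeA => h.
apply: (le_trans (leeD2l _ h)); move: hle; rewrite /Phi.
have : (0 <= \sum_(1 <= n <oo) (phi n r)%:E)%E.
  by apply: nneseries_ge0 => n _ _; rewrite lee_fin.
case: (\sum_(1 <= n <oo) _)%E => [v| |] //; last first.
  by rewrite gt0_muley ?lte_fin.
rewrite lee_fin => v0; rewrite -!EFinM -EFinD !lee_fin => hv.
have := powR_add_le (b0 0%N) hp; rewrite -/(b 0%N).
set y := _ `^ _ => hy.
have : (y + p / 2 * (1 - b 0%N ^+ 2)) * phi 0%N r <= 1 * phi 0%N r.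
  by rewrite ler_wpM2r.
have : (1 - b 0%N ^+ 2) * v <= (1 - b 0%N ^+ 2) * (p / 2 * phi 0%N r).
  by rewrite ler_wpM2l//; lra.
nra.
Qed.

(** For the automorphism with parameter t the Bohr inequality contains
    (1 - t^2) * (sum of t^n * phi (n+1)) <= (1 - t^p) * phi 0, the terms with
    squares being dropped since they are of order (1 - t^2)^2.  The factor t^2
    comes from powR_sub_le and turns the conclusion into one that is polynomial
    in t. *)
Lemma bohr_inequality_moebius (R : realType) (p r t : R)
    (phi : nat -> R -> R) (L : nat) :
  0 < p <= 2 -> 0 < t < 1 -> (forall n, 0 <= phi n r) ->
  bohr_inequality phi p (moebius_coef t) r ->
  t ^+ 2 * (\poly_(n < L) phi n.+1 r).[t] <= p / 2 * phi 0%N r.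
Proof.
move=> hp /andP[t0 t1] phi0; rewrite /bohr_inequality.
have t2 : 0 < 1 - t ^+ 2 by nra.
set S2 := (\sum_(1 <= n <oo) (_ * _))%E => h.
have S20 : (0 <= S2)%E.
  apply: nneseries_ge0 => n _ _.
  apply: mule_ge0; first by rewrite lee_fin sqr_ge0.
  apply: adde_ge0; first by rewrite lee_fin divr_ge0// addr_ge0// normc_ge0.
  by apply: nneseries_ge0 => k _ _; rewrite lee_fin.
have {h S20} := le_trans (leeDl _ S20) h.
have lb : (\sum_(1 <= n < L.+1) (normc (moebius_coef t n) * phi n r)%:E
    <= \sum_(1 <= n <oo) (normc (moebius_coef t n) * phi n r)%:E)%E.
  apply: nneseries_lim_ge => n _ _.
  by rewrite lee_fin mulr_ge0// normc_ge0.
move=> /(le_trans (leeD2l _ lb)) {lb}.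
rewrite sumEFin -EFinD lee_fin.
have -> : normc (moebius_coef t 0) = t by rewrite normc_real gtr0_norm.
rewrite big_add1 succnK.
rewrite (eq_bigr (fun n => (1 - t ^+ 2) * (phi n.+1 r * t ^+ n))); last first.
  move=> n _.
  have -> : moebius_coef t n.+1 = (- ((1 - t ^+ 2) * t ^+ n))%:C.
    by rewrite rmorphN.
  rewrite normc_real normrN ger0_norm.
    by ring.
  by rewrite mulr_ge0 ?exprn_ge0// ltW.
rewrite -mulr_sumr big_mkord horner_poly.
set P := \sum_(_ < _) _ => h.
have tp := powR_sub_le t0 hp.
rewrite -(ler_pM2l t2).
have h1 : (1 - t ^+ 2) * P * t ^+ 2 <= (1 - t `^ p) * phi 0%N r * t ^+ 2.
  by rewrite ler_wpM2r ?sqr_ge0//; lra.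
have h2 : (1 - t `^ p) * t ^+ 2 * phi 0%N r
    <= p / 2 * (1 - t ^+ 2) * phi 0%N r by rewrite ler_wpM2r.
lra.
Qed.

(** The limit t -> 1 is taken in each partial sum of Phi_1, where it concerns
    polynomials in t only. *)
Lemma bohr_inequality_extremal (R : realType) (p r : R) (phi : nat -> R -> R) :
  0 < p <= 2 -> (forall n, 0 <= phi n r) ->
  (forall t, 0 < t < 1 -> bohr_inequality phi p (moebius_coef t) r) ->
  (2%:E * Phi phi 1 r <= (p * phi 0%N r)%:E)%E.
Proof.
move=> hp phi0 H.
have part L : (\sum_(1 <= n < L.+1) (phi n r)%:E <= (p / 2 * phi 0%N r)%:E)%E.
  rewrite sumEFin lee_fin big_add1/= big_mkord.
  have := @poly_ge0_at1 R
    ((p / 2 * phi 0%N r)%:P - 'X^2 * \poly_(n < L) phi n.+1 r).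
  rewrite !hornerE expr1n mul1r subr_ge0 horner_poly.
  under eq_bigr => n _ do rewrite expr1n mulr1.
  apply => t t01; rewrite !hornerE subr_ge0.
  by apply: bohr_inequality_moebius => //; exact: H.
have : (Phi phi 1 r <= (p / 2 * phi 0%N r)%:E)%E.
  apply: lime_le.
    by apply: is_cvg_nneseries => n _ _; rewrite lee_fin.
  exists 1%N => // -[|L] //= _; exact: part.
have -> : (p * phi 0%N r)%:E = (2%:E * (p / 2 * phi 0%N r)%:E)%E.
  by rewrite -EFinM; congr (_ %:E); field.
by apply: lee_wpmul2l; rewrite lee_fin.
Qed.

Theorem theorem1 (R : realType) (p : R) (phi : nat -> R -> R) (r0 : R)
  (hp : 0 < p <= 2) (hphi : classF phi)
  (hr0 : minimal_positive_root phi p r0)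
  (hlt : forall r : R, 0 <= r < r0 ->
     ((p * phi 0%N r)%:E > 2%:E * Phi phi 1 r)%E) :
  (forall (f : R[i] -> R[i]) (a : nat -> R[i]),
     classB f -> expansion_on_disk f a ->
     forall r : R, 0 <= r <= r0 -> bohr_inequality phi p a r)
  /\
  ((exists eps : R, [/\ 0 < eps, r0 + eps <= 1 &
      forall x : R, r0 < x < r0 + eps ->
        ((p * phi 0%N x)%:E < 2%:E * Phi phi 1 x)%E]) ->
   forall r1 : R, r0 < r1 < 1 ->
     ~ (forall (f : R[i] -> R[i]) (a : nat -> R[i]),
          classB f -> expansion_on_disk f a ->
          forall r : R, 0 <= r <= r1 -> bohr_inequality phi p a r)).
Proof.
have [phi0 _ _] := hphi; have [/andP[r00 r01] root _] := hr0.
have phi_ge0 r : 0 <= r < 1 -> forall n, 0 <= phi n r.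
  by move=> r1 n; apply: phi0; rewrite /= in_itv.
split.
  move=> f a fB fa r /andP[r_ge0 r_le].
  apply: bohr_inequality_holds fB fa => //.
    by apply: phi_ge0; rewrite r_ge0 (le_lt_trans r_le).
  move: r_le; rewrite le_eqVlt => /orP[/eqP ->|r_lt]; first by rewrite root.
  by apply/ltW/hlt; rewrite r_ge0.
move=> [eps [eps0 eps1 heps]] r1 /andP[r01' r11] H.
have [x [x0 xe xr]] : exists x, [/\ r0 < x, x < r0 + eps & x < r1].
  exists (r0 + Num.min eps (r1 - r0) / 2).
  have m0 : 0 < Num.min eps (r1 - r0) by rewrite lt_min eps0 subr_gt0.
  have me : Num.min eps (r1 - r0) <= eps by rewrite ge_min lexx.
  have mr : Num.min eps (r1 - r0) <= r1 - r0 by rewrite ge_min lexx orbT.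
  by split; lra.
have := heps x; rewrite x0 xe => /(_ isT); apply/negP; rewrite -leNgt.
apply: bohr_inequality_extremal => //.
  by apply: phi_ge0; apply/andP; split; lra.
move=> t t01; apply: (H (moebius t)).
- exact: moebius_classB.
- exact: moebius_expansion.
by apply/andP; split; lra.
Qed.
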